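(* Let $\{g_l:\mathbb{R}^{p_l}\times\mathbb{R}^{d_{l-1}\times N}\to\mathbb{R}^{d_l\times N}\}_{l=1}^{L}$ be a multilayer parameterised system (a family of continuously differentiable maps, called layers), and let $X\in\mathbb{R}^{d_0\times N}$ be a data matrix, for which the following hold: 1. $d_{l-1}\geq d_l$, and $\|Jg_l(\theta_l,Z)\|_2<1$ for all $\theta_l\in\mathbb{R}^{p_l}$, $Z\in\mathbb{R}^{d_{l-1}\times N}$ and $l\geq 2$; 2. $N\leq d_0$, $X$ is full rank, $p_1\geq d_1d_0$, and $g_1:\mathbb{R}^{p_1}\times\mathbb{R}^{d_0\times N}\to\mathbb{R}^{d_1\times N}$ is a $P$-parameterised affine layer, for which $DP(\theta_1)$ is full rank for all $\theta_1\in\mathbb{R}^{p_1}$. For any sequence $\{I_l:\mathbb{R}^{d_{l-1}\times N}\to\mathbb{R}^{d_l\times N}\}_{l=2}^L$ of linear maps whose singular values are all equal to $1$, define a new multilayer parameterised system $\{f_l\}_{l=1}^L$ by $f_1:=g_1$ and $f_l(\theta_l,Z):=I_lZ+g_l(\theta_l,Z)$ for $2\leq l\leq L$. Let $p=\sum_{l=1}^Lp_l$ and let $F:\mathbb{R}^p\to\mathbb{R}^{d_L\times N}$ be the parameter-function map associated to $\{f_l\}_{l=1}^L$ and $X$. Then $\lambda(DF(\vec\theta))>0$ (but not uniformly so) for all $\vec\theta\in\mathbb{R}^p$.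
   Context: $Jg_l$ denotes the derivative of $g_l$ with respect to its input variable in $\mathbb{R}^{d_{l-1}\times N}$, and $\|\cdot\|_2$ is the operator norm with respect to Euclidean (Frobenius) norms on matrix spaces. A $P$-parameterised affine layer is here a map $(\theta_1,Z)\mapsto P(\theta_1)Z$, where $P:\mathbb{R}^{p_1}\to\mathbb{R}^{d_1\times d_0}$ is continuously differentiable with derivative $DP$. The parameter-function map is $F(\vec\theta)=f_L(\theta_L)\circ\cdots\circ f_1(\theta_1)(X)$ for $\vec\theta=(\theta_1,\dots,\theta_L)$, where $f_l(\theta_l)$ is the map $Z\mapsto f_l(\theta_l,Z)$. Derivatives such as $DF(\vec\theta)$ are regarded as matrices after vectorising; for a real matrix $A$, $\lambda(A)$ denotes the smallest eigenvalue of $AA^T$. ''Not uniformly so'' means that the positivity of $\lambda(DF(\vec\theta))$ is not uniform in $\vec\theta\in\mathbb{R}^p$.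
   Formalization: ''Not uniformly so'' fails for some systems (one layer, P(θ) = θ reshaped: λ(DF) is a positive constant), so it is proved as: for every choice of dimensions, X and I_l there is a system satisfying the hypotheses with no positive lower bound on λ(DF) over all parameters. *)

(* Defs.v *)
From HB Require Import structures.
From mathcomp Require Import all_boot all_order all_algebra.
From mathcomp Require Import all_classical all_reals all_analysis.

Set Implicit Arguments.
Unset Strict Implicit.
Unset Printing Implicit Defensive.

Import Order.TTheory GRing.Theory Num.Theory.
Import numFieldNormedType.Exports.

Local Open Scope classical_set_scope.
Local Open Scope ring_scope.

Section Defs.
Context {R : realType}.

(* The derivative depends continuously on the base point for the operator
   norm.  The norm that the library puts on matrices is the max norm; since all
   norms are equivalent here, this affects neither [differentiable] nor the
   continuity of ['d f]. *)
Definition C1 {V W : normedModType R} (f : V -> W) : Prop :=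
  (forall x, differentiable f x) /\
  (forall x e, 0 < e ->
     \forall y \near x, forall v, `|'d f y v - 'd f x v| <= e * `|v|).

Definition frobenius m n (A : 'M[R]_(m, n)) : R :=
  Num.sqrt (\sum_(i < m) \sum_(j < n) A i j ^+ 2).

(* Only meaningful for linear [T]: the set is then bounded, so that [sup] is
   the actual supremum. *)
Definition opnorm m n m' n' (T : 'M[R]_(m, n) -> 'M[R]_(m', n')) : R :=
  sup [set frobenius (T Z) | Z in [set Z | frobenius Z <= 1]].

Definition full_rank m n (A : 'M[R]_(m, n)) : Prop := \rank A = minn m n.

(* MathComp matrices act on row vectors on the right, whence the transposes in
   [linear_mx] and [derivative_mx]: these matrices act on column vectors, and
   the derivative has one row per output coordinate. *)
Definition linear_mx m n m' n' (T : {linear 'M[R]_(m, n) -> 'M[R]_(m', n')}) :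
    'M[R]_(m' * n', m * n) :=
  (lin_mx T)^T.

Definition derivative_mx q m n (f : 'rV[R]_q -> 'M[R]_(m, n)) (x : 'rV[R]_q) :
    'M[R]_(m * n, q) :=
  ('J (fun y => mxvec (f y)) x)^T.

(* The min(m, n) singular values of an m x n matrix are the square roots of the
   eigenvalues of the smaller of its two Gram matrices; in particular 0 is one
   of them iff the matrix is not of full rank. *)
Definition singular_value m n (A : 'M[R]_(m, n)) (s : R) : Prop :=
  0 <= s /\
  (if (m <= n)%N then eigenvalue (A *m A^T) (s ^+ 2)
   else eigenvalue (A^T *m A) (s ^+ 2)).

(* For m > 0 the set of eigenvalues of the symmetric matrix A A^T is finite and
   nonempty, so that this infimum is attained. *)
Definition lambda m n (A : 'M[R]_(m, n)) : R :=
  inf [set a : R | eigenvalue (A *m A^T) a].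

Definition affine_layer q m n N (P : 'rV[R]_q -> 'M[R]_(m, n))
    (g : 'rV[R]_q * 'M[R]_(n, N) -> 'M[R]_(m, N)) : Prop :=
  C1 P /\ forall theta Z, g (theta, Z) = P theta *m Z.

(* Layers are numbered from 0: the layer of index l < L maps
   R^(p l) x R^(d l x N) to R^(d l.+1 x N). *)
Definition layers L N (d : nat -> nat) (p : 'I_L -> nat) : Type :=
  forall l : 'I_L, 'rV[R]_(p l) * 'M[R]_(d l, N) -> 'M[R]_(d l.+1, N).

(* The output of the first k layers; [submxrow theta l] is the block of theta
   that holds the parameters of layer l. *)
Fixpoint forward L N (d : nat -> nat) (p : 'I_L -> nat) (f : layers N d p)
    (X : 'M[R]_(d 0%N, N)) (theta : 'rV[R]_(\sum_(l < L) p l)) (k : nat) :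
    (k <= L)%N -> 'M[R]_(d k, N) :=
  match k with
  | 0 => fun=> X
  | k'.+1 => fun lt_k'L =>
      let l : 'I_L := Ordinal lt_k'L in
      f l (submxrow theta l, forward f X theta (ltnW lt_k'L))
  end.

Definition param_fun L N (d : nat -> nat) (p : 'I_L -> nat) (f : layers N d p)
    (X : 'M[R]_(d 0%N, N)) (theta : 'rV[R]_(\sum_(l < L) p l)) : 'M[R]_(d L, N) :=
  forward f X theta (leqnn L).

(* [I ord0] is not used: the first layer has no skip connection. *)
Definition add_skips L N (d : nat -> nat) (p : 'I_L.+1 -> nat)
    (I : forall l : 'I_L.+1, {linear 'M[R]_(d l, N) -> 'M[R]_(d l.+1, N)})
    (g : layers N d p) : layers N d p :=
  fun l thZ => if l == ord0 then g l thZ else I l thZ.2 + g l thZ.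

Definition admissible L N (d : nat -> nat) (p : 'I_L.+1 -> nat) (g : layers N d p) : Prop :=
  [/\ forall l, C1 (g l),
      forall (l : 'I_L.+1), (0 < l)%N -> forall theta Z,
        opnorm ('d (fun Z' => g l (theta, Z')) Z) < 1
    & exists2 P : 'rV[R]_(p ord0) -> 'M[R]_(d 1%N, d 0%N),
        affine_layer P (g ord0)
      & forall theta, full_rank (derivative_mx P theta)].

End Defs.

(* Main.v *)
Require Import Defs.
From HB Require Import structures.
From mathcomp Require Import all_boot all_order all_algebra.
From mathcomp Require Import all_classical all_reals all_analysis.
From mathcomp Require Import spectral complex.

Set Implicit Arguments.
Unset Strict Implicit.
Unset Printing Implicit Defensive.

Import Order.TTheory GRing.Theory Num.Theory.
Import numFieldNormedType.Exports.

Local Open Scope classical_set_scope.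
Local Open Scope ring_scope.

(* Perturbing only the parameters of the first layer moves its output in all
   directions, since DP has full row rank and X has a left inverse.  A later
   layer has derivative I + G in its input, where I I^T = 1 and |G| < 1, so
   y + G I^T y = 0 forces |y| = |G I^T y| < |y| unless y = 0: the square matrix
   (I + G) I^T is invertible and I + G is surjective.  By the chain rule DF has
   full row rank.

   Positivity is not uniform for P = arctan entrywise and g_l = 0 for l >= 2.
   There F is a fixed linear function of the entrywise arctan of theta_1, so at
   the point all of whose coordinates are t, DF is (1 + t^2)^-1 times DF at 0,
   and lambda is at most (1 + t^2)^-2 times an eigenvalue of DF(0) DF(0)^T. *)

(** * Spectral theory of real symmetric matrices *)

(** Over [R[i]] the matrix is Hermitian, hence normal and unitarily diagonalisable, with real
    eigenvalues. Only the eigenvalues are brought back to [R]; the eigenbasis [P] stays complex,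
    which is enough to identify [A]. *)
Lemma symmetric_spectral (R : rcfType) n (A : 'M[R]_n) : A^T = A ->
  exists (P : 'M[R[i]]_n) (d : 'rV[R]_n), [/\ P \in unitmx,
    forall i, eigenvalue A (d 0 i) &
    map_mx (real_complex R) A
      = invmx P *m diag_mx (map_mx (real_complex R) d) *m P].
Proof.
move=> symA; set B := map_mx _ A.
have hermB : B \is hermsymmx.
  apply/is_hermitianmxP; rewrite expr0 scale1r; apply/matrixP => i j.
  rewrite !mxE -[in LHS]symA mxE; apply/eqP.
  by rewrite eq_complex /= oppr0 !eqxx.
have normB : B \is normalmx by apply: hermitian_normalmx.
have /orthomx_spectralP eB := normB.
have realB := hermitian_spectral_diag_real hermB.
pose d := map_mx (@complex.Re R) (spectral_diag B).
have ed : map_mx (real_complex R) d = spectral_diag B.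
  apply/matrixP => i j; rewrite !mxE.
  have /mxOverP/(_ i j) := realB.
  by case: (spectral_diag B i j) => a b; rewrite complex_real => /eqP /= ->.
exists (spectralmx B), d; split; rewrite ?ed //; first exact: spectral_unit.
(* Being an eigenvalue is invariant under field extension, so a row of the complex eigenbasis can
   serve as eigenvector. *)
move=> i; rewrite -(eigenvalue_map (real_complex R)); apply/eigenvalueP.
exists (row i (spectralmx B)).
  rewrite -/B [in X in _ *m X]eB -!row_mul !mulmxA mulmxV ?spectral_unit //.
  rewrite mul1mx row_mul row_diag_mx -scalemxAl -rowE.
  by rewrite -ed !mxE.
apply: contraTneq (spectral_unit B) => r0.
rewrite -row_free_unit; apply/negP => /row_freeP[Q PQ].
have := congr1 (row i) PQ; rewrite row_mul r0 mul0mx => /rowP/(_ i).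
by rewrite !mxE eqxx => /eqP; rewrite eq_sym oner_eq0.
Qed.

Lemma symmetric_eigenvalue (R : rcfType) n (A : 'M[R]_n) :
  (0 < n)%N -> A^T = A -> exists a, eigenvalue A a.
Proof.
move=> n0 /symmetric_spectral[P [d [_ ed _]]].
by exists (d 0 (Ordinal n0)).
Qed.

(** A diagonalisable matrix with all eigenvalues [c] is conjugate to [c%:M], and conjugation fixes
    scalar matrices. *)
Lemma symmetric_scalar (R : rcfType) n (A : 'M[R]_n) (c : R) :
  A^T = A -> (forall a, eigenvalue A a -> a = c) -> A = c%:M.
Proof.
move=> /symmetric_spectral[P [d [uP ed eA]]] ec.
apply: (map_mx_inj (f := real_complex R)); rewrite eA.
have -> : d = const_mx c by apply/rowP => i; rewrite mxE; exact: ec.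
rewrite map_const_mx diag_const_mx map_scalar_mx mul_mx_scalar.
by rewrite -scalemxAl mulVmx // scalemx1.
Qed.

(** * Continuity of linear maps and of the product of matrices *)

Section MatrixCalculus.
Context {R : realType}.

Lemma continuous_sum (T : topologicalType) (V : normedModType R) (J : Type)
    (r : seq J) (f : J -> T -> V) :
  (forall j, continuous (f j)) -> continuous (fun x => \sum_(j <- r) f j x).
Proof.
move=> fc; elim: r => [|j r IH] x.
  by under eq_fun do rewrite big_nil; exact: cvg_cst.
by under eq_fun do rewrite big_cons; apply: cvgD; [exact: fc | exact: IH].
Qed.

Lemma mx_linear_continuous m n (V : normedModType R)
  (f : {linear 'M[R]_(m, n) -> V}) : continuous f.
Proof.
have -> : (f : _ -> _) = fun A => \sum_i \sum_j A i j *: f (delta_mx i j).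
  apply/funext => A; rewrite {1}(matrix_sum_delta A) linear_sum.
  apply: eq_bigr => i _; rewrite linear_sum; apply: eq_bigr => j _.
  exact: linearZ.
apply: continuous_sum => i; apply: continuous_sum => j A.
exact: (cvgZr_tmp (F := nbhs A)) (@coord_continuous R m n i j A).
Qed.

Lemma mulmx_continuous m n q :
  continuous (fun p : 'M[R]_(m, n) * 'M[R]_(n, q) => p.1 *m p.2).
Proof.
have -> : (fun p : 'M[R]_(m, n) * 'M[R]_(n, q) => p.1 *m p.2) =
    fun p => \sum_i \sum_j \sum_k (p.1 i k * p.2 k j) *: delta_mx i j.
  apply/funext => p; rewrite [LHS]matrix_sum_delta.
  apply: eq_bigr => i _; apply: eq_bigr => j _.
  by rewrite mxE scaler_suml.
do 2![apply: continuous_sum => ?]; apply: continuous_sum => k p.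
apply: (cvgZr_tmp (F := nbhs p)); apply: (cvgM (F := nbhs p)).
  exact: (continuous_comp cvg_fst (@coord_continuous R m n _ _ p.1)).
exact: (continuous_comp cvg_snd (@coord_continuous R n q _ _ p.2)).
Qed.
End MatrixCalculus.

(** * Frobenius and operator norms *)

Section Frobenius.
Context {R : realType}.

(** This form lets norms be computed with the matrices [lin_mx], which act on [mxvec A]. *)
Lemma frobeniusE m n (A : 'M[R]_(m, n)) :
  frobenius A = Num.sqrt ((mxvec A *m (mxvec A)^T) 0 0).
Proof.
congr Num.sqrt; rewrite mxE pair_bigA /=.
rewrite [RHS](reindex _ (curry_mxvec_bij _ _)); apply: eq_bigr => -[i j] _ /=.
by rewrite mxE mxvecE expr2.
Qed.

Lemma frobenius_ge0 m n (A : 'M[R]_(m, n)) : 0 <= frobenius A.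
Proof. exact: sqrtr_ge0. Qed.

Lemma mul_trmx_ge0 n (v : 'rV[R]_n) : 0 <= (v *m v^T) 0 0.
Proof. by rewrite mxE sumr_ge0 // => i _; rewrite mxE -expr2 sqr_ge0. Qed.

Lemma mul_trmx_eq0 n (v : 'rV[R]_n) : ((v *m v^T) 0 0 == 0) = (v == 0).
Proof.
apply/eqP/eqP => [|->]; last by rewrite mul0mx mxE.
rewrite mxE => /eqP; rewrite psumr_eq0 => [/allP v0|i _]; last first.
  by rewrite mxE -expr2 sqr_ge0.
apply/rowP => i; have := v0 i (mem_index_enum i).
by rewrite /= mxE mulf_eq0 orbb mxE => /eqP.
Qed.

Lemma frobenius_eq0 m n (A : 'M[R]_(m, n)) : (frobenius A == 0) = (A == 0).
Proof.
rewrite frobeniusE -mxvec_eq0 -mul_trmx_eq0 sqrtr_eq0.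
by rewrite le_eqVlt ltNge mul_trmx_ge0 orbF.
Qed.

Lemma frobeniusZ m n a (A : 'M[R]_(m, n)) :
  frobenius (a *: A) = `|a| * frobenius A.
Proof.
rewrite !frobeniusE linearZ /= [(_ *: _)^T]linearZ /= -scalemxAl -scalemxAr.
rewrite scalerA mxE.
by rewrite sqrtrM -?expr2 ?sqr_ge0 // sqrtr_sqr.
Qed.

Lemma ler_coord_norm m n (A : 'M[R]_(m, n)) i j : `|A i j| <= `|A|.
Proof.
by rewrite [leRHS]/Num.Def.normr /= mx_normrE (le_bigmax _ _ (i, j)).
Qed.

Lemma ler_norm_frobenius m n (A : 'M[R]_(m, n)) : `|A| <= frobenius A.
Proof.
rewrite /Num.Def.normr /= mx_normrE; apply: bigmax_le => [|[i j] _ /=].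
  exact: frobenius_ge0.
rewrite -sqrtr_sqr ler_wsqrtr // (bigD1 i) //= (bigD1 j) //= -addrA lerDl.
by rewrite addr_ge0 ?sumr_ge0 // => *; rewrite ?sumr_ge0 // => *; exact: sqr_ge0.
Qed.

Lemma ler_frobenius_norm m n (A : 'M[R]_(m, n)) :
  frobenius A <= Num.sqrt (m * n)%:R * `|A|.
Proof.
rewrite -[X in _ * X]ger0_norm // -sqrtr_sqr -sqrtrM ?ler0n // ler_wsqrtr //.
rewrite pair_bigA /= (@le_trans _ _ (\sum_(ij : 'I_m * 'I_n) `|A| ^+ 2)) //.
  apply: ler_sum => -[i j] _ /=; rewrite -real_normK ?num_real //.
  by rewrite lerXn2r ?nnegrE ?ler_coord_norm.
by rewrite sumr_const card_prod !card_ord mulr_natl.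
Qed.

(** Rescaling [Z] to norm 1 reduces this to the unit ball. The supremum is an upper bound only
    because its set is bounded, which follows from the continuity of [T] and the comparison of the
    max and Frobenius norms. *)
Lemma ler_opnorm m n m' n' (T : {linear 'M[R]_(m, n) -> 'M[R]_(m', n')}) Z :
  frobenius (T Z) <= opnorm T * frobenius Z.
Proof.
have [->|Z0] := eqVneq Z 0.
  have /eqP -> : frobenius (0 : 'M[R]_(m, n)) == 0 by rewrite frobenius_eq0.
  by rewrite mulr0 linear0 le_eqVlt frobenius_eq0 eqxx.
have fZ0 : 0 < frobenius Z by rewrite lt_def frobenius_eq0 Z0 frobenius_ge0.
rewrite -ler_pdivrMr // mulrC -[X in X * _]ger0_norm ?invr_ge0 ?frobenius_ge0 //.
rewrite -frobeniusZ -linearZ /=; apply: ub_le_sup; last first.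
  exists ((frobenius Z)^-1 *: Z) => //=.
  by rewrite frobeniusZ ger0_norm ?invr_ge0 ?frobenius_ge0 // mulVf ?gt_eqF.
have [k k0 Tk] := linear_lipschitz (@mx_linear_continuous _ _ _ _ T).
exists (Num.sqrt (m' * n')%:R * k) => _ [Y /= Y1 <-].
rewrite (le_trans (ler_frobenius_norm _)) // ler_wpM2l ?sqrtr_ge0 //.
rewrite (le_trans (Tk _)) // ler_piMr ?(ltW k0) //.
exact: le_trans (ler_norm_frobenius _) Y1.
Qed.

(** As [lin_mx] acts on rows, the first hypothesis says that [I] composed with its adjoint is the
    identity. Preimages are sought in the range of the adjoint, which makes the system to solve
    square. *)
Lemma opnorm_lt1_surj m n m' n' (I T : {linear 'M[R]_(m, n) -> 'M[R]_(m', n')}) :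
  (lin_mx I)^T *m lin_mx I = 1%:M -> opnorm T < 1 ->
  forall W, exists Z, I Z + T Z = W.
Proof.
move=> II T1.
suff uM : 1%:M + (lin_mx I)^T *m lin_mx T \in unitmx.
  move=> W; set M := _ + _ in uM.
  exists (vec_mx (mxvec W *m invmx M *m (lin_mx I)^T)).
  apply: (can_inj mxvecK); rewrite linearD /= -!mul_rV_lin -!mulmxA -2!mulmxDr II.
  by rewrite mulVmx // mulmx1.
rewrite -row_free_unit -kermx_eq0; apply/eqP/row_matrixP => i; rewrite row0.
set y := row i _; have : y + y *m (lin_mx I)^T *m lin_mx T = 0.
  rewrite -mulmxA -[X in X + _]mulmx1 -mulmxDr; apply/sub_kermxP; exact: row_sub.
set Z := vec_mx (y *m (lin_mx I)^T); rewrite mul_rV_lin -/Z => /eqP.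
rewrite addr_eq0 => /eqP ey.
(* [II] makes the adjoint of [I] isometric, so [Z] has the norm of [y], which is minus the
   vectorised [T Z]. *)
have eZ : frobenius Z = frobenius (T Z).
  rewrite !frobeniusE vec_mxK trmx_mul trmxK mulmxA -[X in X *m _]mulmxA II mulmx1.
  by rewrite ey [(- _)^T]linearN mulNmx mulmxN opprK.
have Z0 : Z = 0.
  apply/eqP; rewrite -frobenius_eq0; apply: contraTT T1 => fZ.
  rewrite -leNgt -(@ler_pM2r _ (frobenius Z)) ?mul1r ?[leLHS]eZ ?ler_opnorm //.
  by rewrite lt_def fZ frobenius_ge0.
by rewrite ey Z0 !linear0.
Qed.
Lemma opnorm0 m n m' n' (T : 'M[R]_(m, n) -> 'M[R]_(m', n')) :
  (forall Z, T Z = 0) -> opnorm T <= 0.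
Proof.
have f0 m1 n1 : frobenius (0 : 'M[R]_(m1, n1)) = 0.
  by apply/eqP; rewrite frobenius_eq0.
move=> T0; apply: ge_sup => [|_ [Z _ <-]]; last by rewrite T0 f0.
by exists (frobenius (T 0)), 0 => //=; rewrite f0.
Qed.

End Frobenius.

(** * Eigenvalues of Gram matrices *)

Section Lambda.
Context {R : realType}.

(** Both sides are [v A A^T v^T]. The identity shows that eigenvalues are nonnegative and, at
    [a = 0], that [A A^T] is invertible when [A] is row free. *)
Lemma gram_eigenvector m n (A : 'M[R]_(m, n)) (v : 'rV[R]_m) a :
  v *m (A *m A^T) = a *: v ->
  ((v *m A) *m (v *m A)^T) 0 0 = a * (v *m v^T) 0 0.
Proof.
by move=> ev; rewrite trmx_mul mulmxA -(mulmxA v) ev -scalemxAl mxE.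
Qed.

Lemma gram_eigenvalue_ge0 m n (A : 'M[R]_(m, n)) a :
  eigenvalue (A *m A^T) a -> 0 <= a.
Proof.
move=> /eigenvalueP[v /gram_eigenvector ev v0].
have vv : 0 < (v *m v^T) 0 0 by rewrite lt_def mul_trmx_eq0 v0 mul_trmx_ge0.
by rewrite -(pmulr_lge0 _ vv) -ev mul_trmx_ge0.
Qed.

Lemma gram_unit m n (A : 'M[R]_(m, n)) :
  row_free A -> A *m A^T \in unitmx.
Proof.
move=> freeA; rewrite -row_free_unit -kermx_eq0; apply/eqP/row_matrixP => i.
rewrite row0; set v := row i _.
have /sub_kermxP v0 : (v <= kermx (A *m A^T))%MS by exact: row_sub.
have /gram_eigenvector : v *m (A *m A^T) = 0 *: v by rewrite v0 scale0r.
rewrite mul0r => /eqP; rewrite mul_trmx_eq0 => /eqP vA.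
by apply: (row_free_inj freeA); rewrite vA mul0mx.
Qed.

Lemma lambda_le m n (A : 'M[R]_(m, n)) a :
  eigenvalue (A *m A^T) a -> lambda A <= a.
Proof.
move=> ea; apply: ge_inf => //.
by exists 0 => b /= /gram_eigenvalue_ge0.
Qed.

(** An eigenvector satisfies [v = a (v M^-1)], so a Lipschitz constant [k] of the inverse forces
    [k^-1 <= a] for all eigenvalues at once. Positivity of [m] makes the spectrum nonempty; the
    infimum of the empty set would be 0. *)
Lemma lambda_gt0 m n (A : 'M[R]_(m, n)) :
  (0 < m)%N -> row_free A -> 0 < lambda A.
Proof.
move=> m0 /gram_unit; set M := A *m A^T => uM.
have [k k0 Mk] :=
  linear_lipschitz (@mx_linear_continuous _ _ _ _
    (mulmxr (invmx M) : {linear 'rV_m -> 'rV_m})).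
apply: (@lt_le_trans _ _ k^-1); first by rewrite invr_gt0.
apply: lb_le_inf.
  by apply: symmetric_eigenvalue => //; rewrite trmx_mul trmxK.
move=> a /= ea; have a0 := gram_eigenvalue_ge0 ea.
have [v ev v0] := eigenvalueP ea.
have : v = a *: (v *m invmx M) by rewrite scalemxAl -ev mulmxK.
move=> /(congr1 Num.norm); rewrite normrZ (ger0_norm a0) => nv.
have : `|v| <= a * (k * `|v|) by rewrite {1}nv ler_wpM2l // Mk.
by rewrite mulrA ler_pMl ?normr_gt0 // -ler_pdivrMr // mul1r.
Qed.

Lemma lambda_scale_le m n (A : 'M[R]_(m, n)) a c :
  eigenvalue (A *m A^T) a -> lambda (c *: A) <= c ^+ 2 * a.
Proof.
move=> /eigenvalueP[v ev v0]; apply/lambda_le/eigenvalueP; exists v => //.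
have -> : (c *: A) *m (c *: A)^T = c ^+ 2 *: (A *m A^T).
  by rewrite [(_ *: _)^T]linearZ /= -scalemxAr -scalemxAl scalerA expr2.
by rewrite -scalemxAr ev scalerA.
Qed.
End Lambda.

(** * Continuously differentiable maps and their composition *)

Section C1Maps.
Context {R : realType}.

Lemma C1_linear (V W : normedModType R) (f : {linear V -> W}) :
  continuous f -> C1 f.
Proof.
move=> cf; split=> [x|x e e0]; first exact: linear_differentiable.
apply: nearW => y v; rewrite !diff_lin // subrr normr0.
by rewrite mulr_ge0 // ltW.
Qed.

Lemma C1_mx_linear m n (W : normedModType R) (f : {linear 'M[R]_(m, n) -> W}) :
  C1 f.
Proof. exact: C1_linear (@mx_linear_continuous _ _ _ _ f). Qed.

Lemma C1_cst (V W : normedModType R) (a : W) : C1 (fun _ : V => a).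
Proof.
split=> [x|x e e0]; first exact: differentiable_cst.
apply: nearW => y v; rewrite -/(cst a) !diff_cst subrr normr0.
by rewrite mulr_ge0 // ltW.
Qed.

(** The differential depends linearly on its base point, so its variation from [x] to [y] is a sum
    of two values of [f], each at most [k * |y - x| * |v|]. This explains the radius
    [e / (k + k)]. *)
Lemma C1_bilinear (U V W : normedModType R) (f : {bilinear U -> V -> W}) :
  continuous (fun p => f p.1 p.2) -> C1 (fun p : U * V => f p.1 p.2).
Proof.
move=> cf; split=> [x|x e e0]; first exact: differentiable_bilin.
have [k k0 fk] := bilinear_schwarz cf.
have d0 : 0 < e / (k + k) by rewrite divr_gt0 ?addr_gt0.
near=> y => v; rewrite !diff_bilin //.
rewrite opprD addrACA -linearBl -linearBr /=.
have : `|y - x| <= e / (k + k).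
  rewrite distrC; near: y; apply: nbhs_le_nbhs_norm.
  by exists (e / (k + k)) => // z /= /ltW.
rewrite prod_normE ge_max /= => /andP[h1 h2].
have : `|v| <= `|v| by [].
rewrite {1}prod_normE ge_max => /andP[v1 v2].
rewrite (le_trans (ler_normD _ _)) //.
have ek : k * (e / (k + k)) + k * (e / (k + k)) = e.
  by rewrite -mulrDl mulrC divfK // gt_eqF // addr_gt0.
rewrite -[X in X * _]ek mulrDl lerD // (le_trans (fk _ _)) //.
  by rewrite ler_pM // ?mulr_ge0 ?(ltW k0) // ler_wpM2l // ltW.
by rewrite -mulrA -[leRHS]mulrA ler_wpM2l ?(ltW k0) // mulrC ler_pM.
Unshelve. all: by end_near. Qed.

Lemma C1_pair (U V W : normedModType R) (f : U -> V) (g : U -> W) :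
  C1 f -> C1 g -> C1 (fun x => (f x, g x)).
Proof.
move=> [df cf] [dg cg]; split=> [x|x e e0]; first exact: differentiable_pair.
near=> y => v; rewrite !diff_pair // prod_normE ge_max /=.
by apply/andP; split; move: v; near: y; [exact: cf|exact: cg].
Unshelve. all: by end_near. Qed.

(** The variation of the differential splits into [('d g (f y) - 'd g (f x)) ('d f y v)] and
    ['d g (f x) ('d f y v - 'd f x v)], each allowed half of [e]. *)
Lemma C1_comp (U V W : normedModType R) (f : U -> V) (g : V -> W) :
  C1 f -> C1 g -> C1 (g \o f).
Proof.
move=> [df cf] [dg cg]; split=> [x|x e e0]; first exact: differentiable_comp.
have [k k0 fk] := linear_lipschitz (diff_continuous (df x)).
have [k' k'0 gk] := linear_lipschitz (diff_continuous (dg (f x))).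
(* The bound [e2 <= 1] keeps ['d f y] below [k + 1], the factor that [e1] compensates; the other
   bound on [e2] compensates [k']. *)
pose e1 := e / 2 / (k + 1); pose e2 := Num.min 1 (e / 2 / k').
have e10 : 0 < e1 by rewrite !divr_gt0 // addr_gt0.
have e20 : 0 < e2 by rewrite lt_min ltr01 !divr_gt0.
near=> y => v.
rewrite (diff_comp (df y) (dg (f y))) (diff_comp (df x) (dg (f x))) /=.
have h2 : `|'d f y v - 'd f x v| <= e2 * `|v|.
  by move: v; near: y; exact: cf.
have h1 u : `|'d g (f y) u - 'd g (f x) u| <= e1 * `|u|.
  move: u; near: y; exact: (differentiable_continuous (df x)) (cg (f x) _ e10).
rewrite -(subrKA ('d g (f x) ('d f y v))) -linearB /=.
rewrite (le_trans (ler_normD _ _)) //.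
rewrite (splitr e) mulrDl lerD //.
  rewrite (le_trans (h1 _)) // -ler_pdivlMl // mulrA invf_div.
  rewrite mulfVK ?gt_eqF ?divr_gt0 //.
  rewrite -(subrK ('d f x v) ('d f y v)) (le_trans (ler_normD _ _)) //.
  rewrite addrC mulrDl lerD // (le_trans h2) // ler_wpM2r //.
  by rewrite /e2 ge_min lexx.
rewrite (le_trans (gk _)) // -ler_pdivlMl // mulrA (le_trans h2) //.
by rewrite ler_wpM2r // mulrC /e2 ge_min lexx orbT.
Unshelve. all: by end_near. Qed.
End C1Maps.

(** * Singular values, derivative matrices and parameter blocks *)

Section Forward.
Context {R : realType}.

(** The inequality of dimensions selects the branch of [singular_value] whose Gram matrix is the one
    in the conclusion. That matrix is symmetric with 1 as its only eigenvalue. *)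
Lemma singular_values1 m n m' n' (T : {linear 'M[R]_(m, n) -> 'M[R]_(m', n')}) :
  (m' * n' <= m * n)%N -> (forall s, singular_value (linear_mx T) s -> s = 1) ->
  (lin_mx T)^T *m lin_mx T = 1%:M.
Proof.
move=> le_mn T1; apply: symmetric_scalar => [|a]; first by rewrite trmx_mul trmxK.
rewrite -[X in _ *m X]trmxK => ea; have a0 := gram_eigenvalue_ge0 ea.
rewrite -(sqr_sqrtr a0) (T1 (Num.sqrt a)) ?expr1n //.
by split; [exact: sqrtr_ge0 | rewrite le_mn sqr_sqrtr].
Qed.

Lemma row_full_surj (F : fieldType) m n (A : 'M[F]_(m, n)) :
  row_full A <-> forall w : 'rV_n, exists v, v *m A = w.
Proof.
split=> [fullA w|surjA].
  by have /submxP[v ->] := submx_full w fullA; exists v.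
rewrite -sub1mx; apply/row_subP => i.
by have [v <-] := surjA (row i 1%:M); rewrite submxMl.
Qed.

Lemma diff_mxvec q m n (f : 'rV[R]_q -> 'M[R]_(m, n)) x v :
  differentiable f x -> v *m (derivative_mx f x)^T = mxvec ('d f x v).
Proof.
move=> df; rewrite trmxK mul_rV_lin1 /=.
have cv := @mx_linear_continuous R m n _ mxvec.
rewrite (diff_comp df (linear_differentiable (f x) cv)) /=.
by rewrite (diff_lin (f x) cv).
Qed.

Lemma mulmx_tr_scale (F : comNzRingType) m n (A B : 'M[F]_(m, n)) c :
  (forall v : 'rV_n, v *m A^T = c *: (v *m B^T)) -> A = c *: B.
Proof.
move=> AB; apply: trmx_inj; apply/row_matrixP => i.
by rewrite rowE AB -rowE; apply/rowP => j; rewrite !mxE.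
Qed.

Lemma derivative_mx_scale q m n (f : 'rV[R]_q -> 'M[R]_(m, n)) x y c :
  differentiable f x -> differentiable f y ->
  (forall v, 'd f x v = c *: 'd f y v) ->
  derivative_mx f x = c *: derivative_mx f y.
Proof.
move=> dx dy xy; apply: mulmx_tr_scale => v.
apply: (etrans (diff_mxvec v dx)).
by rewrite xy linearZ (diff_mxvec v dy).
Qed.

(** Passes between rank and surjectivity: the transpose of a row free matrix is row full, and
    vectorisation is bijective. *)
Lemma derivative_mx_row_free q m n (f : 'rV[R]_q -> 'M[R]_(m, n)) x :
  differentiable f x ->
  row_free (derivative_mx f x) <-> forall W, exists v, 'd f x v = W.
Proof.
move=> df; rewrite /row_free -mxrank_tr -/(row_full _) row_full_surj.
split=> [surj W|surj w].
  have [v] := surj (mxvec W); rewrite diff_mxvec // => /(can_inj mxvecK) <-.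
  by exists v.
have [v vw] := surj (vec_mx w).
by exists v; rewrite diff_mxvec // vw vec_mxK.
Qed.

(** The contraction hypothesis concerns the input variable alone; the chain rule through
    [z' => (u, z')] locates that partial differential inside the full one. *)
Lemma diff_partial2 (U V W : normedModType R) (g : U * V -> W) u z h :
  differentiable g (u, z) ->
  'd g (u, z) (0, h) = 'd (fun z' => g (u, z')) z h.
Proof.
move=> dg.
have dz : is_diff z (fun z' : V => (u, z')) (fun h => (0, h)).
  exact: is_diff_pair (is_diff_cst u z) (is_diff_id z).
have := @diff_comp _ _ _ _ (fun z' => (u, z')) g z ex_diff dg.
by rewrite diff_val => ->.
Qed.

Variables (L : nat) (p : 'I_L -> nat).

(** Names [submxrow] so that a linear structure can be attached to it. *)
Definition block (l : 'I_L) (th : 'rV[R]_(\sum_l p l)) : 'rV[R]_(p l) :=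
  submxrow th l.

Fact block_is_linear l : linear (block l).
Proof. by move=> a u v; apply/rowP => j; rewrite !mxE. Qed.

HB.instance Definition _ l :=
  GRing.isLinear.Build R _ _ _ (block l) (block_is_linear l).

Lemma is_diff_block l th : is_diff th (block l) (block l).
Proof.
have cb := @mx_linear_continuous R _ _ _ (block l).
by apply: DiffDef; [exact: linear_differentiable | exact: diff_lin].
Qed.

(** Padding by zeros. The width of a block depends on its index, so [v] has to be transported along
    a proof of [l = j]. *)
Definition embed_block (l : 'I_L) (v : 'rV[R]_(p l)) : 'rV[R]_(\sum_l p l) :=
  \mxrow_j (if l =P j is ReflectT e then castmx (erefl, congr1 p e) v else 0).

Lemma block_embed l v : block l (embed_block v) = v.
Proof.
rewrite /block mxrowK; case: eqP => // e.
by rewrite (eq_axiomK e) castmx_id.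
Qed.

Lemma block_embed_neq l j v : l != j -> block j (@embed_block l v) = 0.
Proof. by rewrite /block mxrowK; case: eqP. Qed.

End Forward.

(** * Surjectivity of the derivative of the parameter-function map *)

Section Surjectivity.
Context {R : realType}.
Variables (L N : nat) (d : nat -> nat) (p : 'I_L.+1 -> nat).
Variables (X : 'M[R]_(d 0%N, N)).
Variable I : forall l : 'I_L.+1, {linear 'M[R]_(d l, N) -> 'M[R]_(d l.+1, N)}.
Variable g : @layers R L.+1 N d p.
Arguments g : clear implicits.
Let f := add_skips I g.
Hypothesis Cg : forall l, C1 (g l).

Lemma forward1E th (lt0 : (0 < L.+1)%N) :
  forward f X th lt0 = g ord0 (block ord0 th, X).
Proof.
(* With the canonical proof inside it, the index of the layer becomes convertible to [ord0], and so
   do the dependent types. *)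
by rewrite (bool_irrelevance lt0 (ltn0Sn L)) /= /f /add_skips eqxx.
Qed.

Lemma forwardSE k th (ltk : (k.+1 < L.+1)%N) (l := Ordinal ltk) :
  forward f X th ltk = I l (forward f X th (ltnW ltk)) +
    g l (block l th, forward f X th (ltnW ltk)).
Proof. by []. Qed.

Lemma is_diff_layer k th (ltk : (k.+1 < L.+1)%N) (l := Ordinal ltk)
    (F := fun th => forward f X th (ltnW ltk)) :
  differentiable F th ->
  is_diff th (fun th => forward f X th ltk)
    (fun v => I l ('d F th v) + 'd (g l) (block l th, F th) (block l v, 'd F th v)).
Proof.
move=> dF.
have cI := @mx_linear_continuous R _ _ _ (I l).
have dI : is_diff (F th) (I l) (I l).
  by apply: DiffDef; [exact: linear_differentiable | exact: diff_lin].
have dIF : is_diff th (I l \o F) (I l \o 'd F th).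
  by apply: is_diff_comp; exact: differentiableP.
have db : is_diff th (fun th => (block l th, F th))
    (fun v => (block l v, 'd F th v)).
  by apply: is_diff_pair; [exact: is_diff_block | exact: differentiableP].
have dg := differentiableP ((Cg l).1 (block l th, F th)).
exact: is_diffD dIF (is_diff_comp db dg).
Qed.

Lemma is_diff_forward1 th (lt0 : (0 < L.+1)%N) :
  is_diff th (fun th => forward f X th lt0)
    (fun v => 'd (g ord0) (block ord0 th, X) (block ord0 v, 0)).
Proof.
have -> : (fun th => forward f X th lt0) = fun th => g ord0 (block ord0 th, X).
  by apply/funext => ?; exact: forward1E.
have db : is_diff th (fun th => (block ord0 th, X)) (fun v => (block ord0 v, 0)).
  by apply: is_diff_pair; exact: is_diff_block.
have dg := differentiableP ((Cg ord0).1 (block ord0 th, X)).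
exact: is_diff_comp db dg.
Qed.

Lemma differentiable_forward k (ltk : (k < L.+1)%N) th :
  differentiable (fun th => forward f X th ltk) th.
Proof.
elim: k ltk th => [|k IH] ltk th; first by have [] := is_diff_forward1 th ltk.
by have [] := is_diff_layer (IH (ltnW ltk) th).
Qed.

Hypothesis first_surj : forall th W, exists v,
  'd (g ord0) (th, X) (v, 0) = W.
Hypothesis layer_surj : forall (l : 'I_L.+1), (0 < l)%N -> forall th Z W,
  exists H, I l H + 'd (fun Z' => g l (th, Z')) Z H = W.

(** Restricting to directions in the first block is what carries the induction: block [l] of such a
    direction vanishes at later layers, so the derivative there is [I l] plus the input
    differential, applied to an arbitrary [H] reached by the earlier layers. *)
Lemma forward_surj k (ltk : (k < L.+1)%N) th W :
  exists v, 'd (fun th => forward f X th ltk) th (embed_block (l := ord0) v) = W.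
Proof.
elim: k ltk W => [|k IH] ltk W.
  have [v <-] := first_surj (block ord0 th) W; exists v.
  have -> := diff_val (is_diff_def := is_diff_forward1 th ltk).
  by rewrite block_embed.
set l := Ordinal ltk.
have [H <-] := layer_surj (l := l) isT (block l th) (forward f X th (ltnW ltk)) W.
have [v <-] := IH (ltnW ltk) H; exists v.
have dF := differentiable_forward (ltnW ltk) th.
have -> := diff_val (is_diff_def := is_diff_layer dF).
by rewrite block_embed_neq // diff_partial2 //; exact: (Cg l).1.
Qed.

End Surjectivity.

(** With [Y] a left inverse of [X], a direction [v] in which [P] has derivative [W Y] gives
    [W Y X = W]. Freezing the input at [X] turns [g] into [P] followed by the linear map of right
    multiplication by [X]. *)
Lemma affine_layer_surj (R : realType) q m n N (P : 'rV[R]_q -> 'M[R]_(m, n))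
    (g : 'rV[R]_q * 'M[R]_(n, N) -> 'M[R]_(m, N)) (X : 'M[R]_(n, N)) :
  (N <= n)%N -> full_rank X -> (m * n <= q)%N -> affine_layer P g ->
  (forall x, differentiable g x) ->
  (forall th, full_rank (derivative_mx P th)) ->
  forall th W, exists v, 'd g (th, X) (v, 0) = W.
Proof.
move=> leNn rX leq [[dP _] gE] dg rP th W.
have /row_fullP[Y YX] : row_full X by rewrite /row_full rX (minn_idPr leNn).
have : row_free (derivative_mx P th).
  by rewrite /row_free rP (minn_idPl leq).
rewrite derivative_mx_row_free // => /(_ (W *m Y))[v vW]; exists v.
have dz : is_diff th (fun th => (th, X)) (fun h => (h, 0)).
  exact: is_diff_pair (is_diff_id th) (is_diff_cst X th).
have dz' : differentiable (fun th => (th, X)) th by case: dz.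
have := congr1 (fun h => h v) (diff_comp dz' (dg (th, X))).
rewrite diff_val /= => <-.
have -> : g \o (fun th => (th, X)) = mulmxr X \o P.
  by apply/funext => t /=; rewrite gE.
have cX := @mx_linear_continuous R _ _ _
  (mulmxr X : {linear 'M[R]_(m, n) -> 'M[R]_(m, N)}).
rewrite (diff_comp (dP th) (linear_differentiable (P th) cX)) /=.
by rewrite (diff_lin (P th) cX) /= vW -mulmxA YX mulmx1.
Qed.

(** * The entrywise arctangent *)

Section Arctangent.
Context {R : realType}.

Definition atan_slope (t : R) : R := (1 + t ^+ 2)^-1.

Lemma atan_slope_gt0 t : 0 < atan_slope t.
Proof. by rewrite invr_gt0 ltr_pwDl // sqr_ge0. Qed.

Lemma continuous_atan_slope : continuous atan_slope.
Proof.
move=> t; apply: cvgV; first by rewrite gt_eqF // ltr_pwDl // sqr_ge0.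
by apply: cvgD; [exact: cvg_cst | exact: exprn_continuous].
Qed.

Variable q : nat.
Implicit Types x v : 'rV[R]_q.

Lemma derive_coord x v k : 'D_v (fun y : 'rV[R]_q => y 0 k) x = v 0 k.
Proof.
have dx : derivable (@id 'rV[R]_q) x v by exact: derivable_id.
have := derive_mx dx; rewrite derive_id => /matrixP/(_ 0 k).
by rewrite mxE.
Qed.

Lemma differentiable_atan_coord x k :
  differentiable (fun y : 'rV[R]_q => atan (y 0 k)) x.
Proof.
apply: (differentiable_comp (differentiable_coord x 0 k)).
exact/derivable1_diffP/derivable_atan.
Qed.

Lemma diff_atan_coord x v k :
  'd (fun y : 'rV[R]_q => atan (y 0 k)) x v = atan_slope (x 0 k) * v 0 k.
Proof.
have da : differentiable atan (x 0 k) by exact/derivable1_diffP/derivable_atan.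
have dc : differentiable (fun y : 'rV[R]_q => y 0 k) x.
  exact: differentiable_coord.
rewrite (diff_comp dc da) /= diff1E //= derive1_atan -deriveE // derive_coord.
by rewrite mulrC.
Qed.

Lemma differentiable_map_atan x : differentiable (map_mx atan : 'rV_q -> 'rV_q) x.
Proof.
have -> : (map_mx atan : 'rV_q -> 'rV_q) =
    \sum_(k < q) fun y : 'rV[R]_q => atan (y 0 k) *: delta_mx 0 k.
  apply/funext => y; rewrite fct_sumE [LHS]row_sum_delta.
  by apply: eq_bigr => k _; rewrite mxE.
apply: differentiable_sum => k; apply: differentiableZl.
exact: differentiable_atan_coord.
Qed.

Lemma diff_map_atan x v :
  'd (map_mx atan : 'rV_q -> 'rV_q) x v = \row_k (atan_slope (x 0 k) * v 0 k).
Proof.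
have da := differentiable_map_atan x.
rewrite -deriveE // derive_mx; last exact: diff_derivable.
apply/rowP => k; rewrite !mxE -diff_atan_coord -deriveE.
  by congr ('D_v _ x); apply/funext => y; rewrite mxE.
exact: differentiable_atan_coord.
Qed.

(** Differentials are diagonal, so their difference is bounded in max norm by the largest difference
    of slopes; there are finitely many coordinates to make close. *)
Lemma C1_map_atan : C1 (map_mx atan : 'rV[R]_q -> 'rV[R]_q).
Proof.
split=> [|x e e0]; first exact: differentiable_map_atan.
have close k : \forall y \near x,
    `|atan_slope (x 0 k) - atan_slope ((y : 'rV[R]_q) 0 k)| <= e.
  have ck : {for x, continuous (fun y : 'rV[R]_q => atan_slope (y 0 k))}.
    exact: continuous_comp (@coord_continuous R 1 q 0 k x)
      (@continuous_atan_slope _).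
  by move/cvgrPdist_le : ck; apply.
near=> y => v.
have cy : forall k, `|atan_slope (x 0 k) - atan_slope (y 0 k)| <= e.
  by near: y; exact: (filter_forall (F := nbhs x) _ close).
have -> : 'd (map_mx atan : 'rV[R]_q -> 'rV[R]_q) y v - 'd (map_mx atan) x v =
    \row_k ((atan_slope (y 0 k) - atan_slope (x 0 k)) * v 0 k).
  apply: (etrans (congr2 (fun a b => a - b) (diff_map_atan y v)
    (diff_map_atan x v))).
  by apply/rowP => k; rewrite !mxE mulrBl.
rewrite [leLHS]/Num.Def.normr /= mx_normrE.
apply: bigmax_le => [|[i k] _]; first by rewrite mulr_ge0 // ltW.
by rewrite mxE /= normrM ler_pM // ?ler_coord_norm // distrC.
Unshelve. all: by end_near. Qed.
End Arctangent.

(** * An affine layer with arctangent weights *)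

Section AtanLayer.
Context {R : realType}.

(** [pid_mx] truncates to the first [m * n] parameters when there are more. *)
Definition atan_mx q m n (th : 'rV[R]_q) : 'M[R]_(m, n) :=
  vec_mx (map_mx atan th *m pid_mx (m * n)).

Definition atan_layer q m n N (thZ : 'rV[R]_q * 'M[R]_(n, N)) : 'M[R]_(m, N) :=
  atan_mx m n thZ.1 *m thZ.2.

Definition mulmx_vec q m n (T : 'M[R]_(q, m * n)) (u : 'rV[R]_q) : 'M[R]_(m, n) :=
  vec_mx (u *m T).

Fact mulmx_vec_is_linear q m n (T : 'M[R]_(q, m * n)) : linear (mulmx_vec T).
Proof. by move=> a u v; rewrite /mulmx_vec mulmxDl -scalemxAl linearP. Qed.

HB.instance Definition _ q m n (T : 'M[R]_(q, m * n)) :=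
  GRing.isLinear.Build R _ _ _ (mulmx_vec T) (mulmx_vec_is_linear T).

Lemma diff_mulmx_vec_atan q m n (T : 'M[R]_(q, m * n)) x v :
  'd (mulmx_vec T \o map_mx atan) x v =
  mulmx_vec T (\row_k (atan_slope (x 0 k) * v 0 k)).
Proof.
have cT := @mx_linear_continuous R _ _ _ (mulmx_vec T).
rewrite (diff_comp (differentiable_map_atan x) (linear_differentiable _ cT)) /=.
by rewrite (diff_lin _ cT) diff_map_atan.
Qed.

Lemma C1_atan_mx q m n : C1 (@atan_mx q m n).
Proof.
exact: C1_comp (@C1_map_atan R q) (C1_mx_linear (mulmx_vec (pid_mx (m * n)))).
Qed.

Lemma C1_atan_layer q m n N : C1 (@atan_layer q m n N).
Proof.
have Cfst : C1 (fst : 'rV[R]_q * 'M[R]_(n, N) -> 'rV[R]_q).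
  by apply: C1_linear => z; exact: cvg_fst.
have Csnd : C1 (snd : 'rV[R]_q * 'M[R]_(n, N) -> 'M[R]_(n, N)).
  by apply: C1_linear => z; exact: cvg_snd.
have Cmul := C1_bilinear (@mulmx_continuous R m n N).
exact: C1_comp (C1_pair (C1_comp Cfst (@C1_atan_mx q m n)) Csnd) Cmul.
Qed.

(** A preimage of [W] is its vectorisation padded with zeros, each coordinate divided by the
    positive slope there. *)
Lemma full_rank_atan_mx q m n x :
  (m * n <= q)%N -> full_rank (derivative_mx (@atan_mx q m n) x).
Proof.
move=> le_q; rewrite /full_rank (minn_idPl le_q); apply/eqP.
change (row_free (derivative_mx (@atan_mx q m n) x)).
apply/derivative_mx_row_free => [|W]; first exact: (C1_atan_mx q m n).1.
pose u : 'rV[R]_q := mxvec W *m pid_mx (m * n).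
exists (\row_k ((atan_slope (x 0 k))^-1 * u 0 k)).
rewrite [LHS]diff_mulmx_vec_atan; set w := \row_k _.
have -> : w = u.
  by apply/rowP => k; rewrite !mxE mulVKf // gt_eqF // atan_slope_gt0.
rewrite /mulmx_vec /u -mulmxA mul_pid_mx minnn (minn_idPr le_q) pid_mx_1.
by rewrite mulmx1 mxvecK.
Qed.
End AtanLayer.

(** * A network whose smallest eigenvalue is not bounded away from 0 *)

Section AtanNetwork.
Context {R : realType}.
Variables (L N : nat) (d : nat -> nat) (p : 'I_L.+1 -> nat).

Definition atan_net : @layers R L.+1 N d p :=
  fun l thZ => if l == ord0 then atan_layer (d l.+1) thZ else 0.

Lemma admissible_atan_net : (d 1 * d 0 <= p ord0)%N -> admissible atan_net.
Proof.
move=> hp; split=> [l|l l0 th Z|].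
- rewrite /atan_net; case: (l == ord0); first exact: C1_atan_layer.
  exact: C1_cst.
- apply: (@le_lt_trans _ _ 0) => //; apply: opnorm0 => Y.
  have l0' : l == ord0 = false by apply/negbTE; rewrite -lt0n in l0 *.
  by rewrite /atan_net l0' -/(cst 0) diff_cst.
exists (@atan_mx R (p ord0) (d 1%N) (d 0%N)).
  split=> [|th Z]; first exact: C1_atan_mx.
  by rewrite /atan_net eqxx.
by move=> th; exact: full_rank_atan_mx.
Qed.

Variables (X : 'M[R]_(d 0%N, N))
  (I : forall l : 'I_L.+1, {linear 'M[R]_(d l, N) -> 'M[R]_(d l.+1, N)}).

(** For fixed [X] the first layer is linear in the arctangents, and each later layer reduces to its
    skip connection, so one matrix [T] absorbs them all. *)
Lemma forward_atan_net k (ltk : (k < L.+1)%N) :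
  exists T, forall th, forward (add_skips I atan_net) X th ltk =
    mulmx_vec T (map_mx atan (block ord0 th)).
Proof.
elim: k ltk => [|k IH] ltk.
  exists (pid_mx (d 1%N * d 0%N) *m lin_mx (mulmxr X)) => th.
  rewrite forward1E /atan_net eqxx /atan_layer /atan_mx /= /mulmx_vec.
  by rewrite mulmxA mul_rV_lin mxvecK.
have [T FT] := IH (ltnW ltk).
exists (T *m lin_mx (I (Ordinal ltk))) => th.
by rewrite forwardSE FT addr0 /mulmx_vec mulmxA mul_rV_lin mxvecK.
Qed.

Lemma derivative_atan_net t :
  let DF := derivative_mx (param_fun (add_skips I atan_net) X) in
  DF (const_mx t) = atan_slope t *: DF 0.
Proof.
have [T FT] := forward_atan_net (leqnn L.+1).
pose A := mulmx_vec T \o map_mx atan.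
have dA x : differentiable A x.
  apply: differentiable_comp; first exact: differentiable_map_atan.
  exact/linear_differentiable/mx_linear_continuous.
have eF : param_fun (add_skips I atan_net) X = A \o block ord0.
  by apply/funext => th; exact: FT.
have dF x : differentiable (A \o block ord0) x.
  by apply: differentiable_comp => //; case: (is_diff_block ord0 x).
have dFE x v : 'd (A \o block ord0) x v =
    mulmx_vec T (\row_k (atan_slope (block ord0 x 0 k) * block ord0 v 0 k)).
  have [b1 b2] := is_diff_block ord0 x.
  by rewrite (diff_comp b1 (dA _)) /= b2 diff_mulmx_vec_atan.
rewrite /= eF; apply: derivative_mx_scale => // v.
apply: (etrans (dFE (const_mx t) v)).
apply: (etrans _ (congr1 (GRing.scale _) (esym (dFE 0 v)))).
rewrite -linearZ; congr (mulmx_vec T _).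
(* All slopes at [const_mx t] are equal, and those at 0 are 1. *)
apply/rowP => k; by rewrite !mxE /atan_slope expr0n addr0 invr1 mul1r.
Qed.
End AtanNetwork.

(** Failure of uniformity is asserted for some system and not for all: with [P] linear and the later
    layers zero, the derivative is constant in [theta]. *)
Theorem theorem4p7 (R : realType) (L N : nat) (d : nat -> nat)
    (p : 'I_L.+1 -> nat) (X : 'M[R]_(d 0%N, N))
    (I : forall l : 'I_L.+1, {linear 'M[R]_(d l, N) -> 'M[R]_(d l.+1, N)})
    (hN : (0 < N)%N)
    (hd : forall l, (l <= L.+1)%N -> (0 < d l)%N)
    (hmono : forall l, (0 < l <= L)%N -> (d l.+1 <= d l)%N)
    (hNd : (N <= d 0)%N)
    (hX : full_rank X)
    (hp : (d 1 * d 0 <= p ord0)%N)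
    (hI : forall l : 'I_L.+1, (0 < l)%N ->
            forall s, singular_value (linear_mx (I l)) s -> s = 1) :
  (forall g : layers N d p, admissible g ->
     forall theta,
       0 < lambda (derivative_mx (param_fun (add_skips I g) X) theta)) /\
  (exists2 g : layers N d p, admissible g &
     ~ exists2 c : R, 0 < c & forall theta,
         c <= lambda (derivative_mx (param_fun (add_skips I g) X) theta)).
Proof.
(* Guarantees that the Gram matrix of the derivative has an eigenvalue. *)
have out_gt0 : (0 < d L.+1 * N)%N by rewrite muln_gt0 hd.
split=> [g [Cg contr [P Paff rP]] th|].
  apply: lambda_gt0 => //; apply/derivative_mx_row_free => [|W].
    exact: differentiable_forward.
  have first_surj := affine_layer_surj hNd hX hp Paff (Cg ord0).1 rP.
  have layer_surj (l : 'I_L.+1) : (0 < l)%N -> forall u Z Y,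
      exists H, I l H + 'd (fun Z' => g l (u, Z')) Z H = Y.
    move=> l0 u Z; apply: opnorm_lt1_surj; last exact: contr.
    apply: singular_values1; last exact: hI.
    by rewrite leq_mul2r hmono ?orbT // l0 -ltnS /=.
  have [v vW] :=
    forward_surj Cg first_surj layer_surj (leqnn L.+1 : (L < L.+1)%N) th W.
  by exists (embed_block v); exact: vW.
exists (@atan_net R L N d p); first exact: admissible_atan_net.
case=> c c0 le_c.
set DF := derivative_mx _ in le_c.
have [a ea] : exists a, eigenvalue (DF 0 *m (DF 0)^T) a.
  by apply: symmetric_eigenvalue => //; rewrite trmx_mul trmxK.
have a0 := gram_eigenvalue_ge0 ea.
(* Chosen so that [a = c * t ^+ 2 < c * (1 + t ^+ 2)], that is, [atan_slope t * a < c]; the second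
   factor [atan_slope t] is merely bounded by 1. *)
pose t := Num.sqrt (a / c).
have t2 : c * t ^+ 2 = a.
  by rewrite sqr_sqrtr ?divr_ge0 // ?ltW // mulrC divfK // gt_eqF.
have := lambda_scale_le (atan_slope t) ea.
rewrite -derivative_atan_net -/DF => /(le_trans (le_c _)).
apply/negP; rewrite -ltNge.
have s0 := atan_slope_gt0 t.
have s1 : atan_slope t <= 1.
  by rewrite invf_le1 ?lerDl ?sqr_ge0 // ltr_pwDl // sqr_ge0.
rewrite (@le_lt_trans _ _ (atan_slope t * a)) //.
  by rewrite ler_wpM2r // expr2 ler_piMr // ltW.
by rewrite mulrC ltr_pdivrMr ?ltr_pwDl ?sqr_ge0 // mulrDr mulr1 t2 ltrDr.
Qed.
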